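(* Consider the $n$-dimensional BML system with direction-change probability $q$, $0\le q<1$, with $m$ particles on the lattice $N_1\times N_2\times\dots\times N_n$ with periodic boundary conditions (as defined in the context), and let $d=\gcd(N_1,N_2,\dots,N_n)$. If $m\le \frac{d}{2}$, then, from any initial state, the system results in a state of free movement after a time interval with finite expectation; that is, for every initial state the random time $T=\min\{t_0\ge 0:\ \text{at time } t_0 \text{ the system is in a state of free movement}\}$ satisfies $\mathbb{E}[T]<\infty$.
   Context: Model. Let $n\ge 1$ and let $N_1,\dots,N_n$ be positive integers. The cells are the points $(x_1,\dots,x_n)$ of $\mathbb{Z}/N_1\times\dots\times\mathbb{Z}/N_n$ (the $j$-th coordinate is taken modulo $N_j$). There are $m$ particles, $1\le m<N_1N_2\cdots N_n$, labelled $s=1,\dots,m$; each cell contains at most one particle. At each time each particle has one of $n$ types $1,\dots,n$. A state of the system is the assignment of positions (distinct cells) and types to all particles. Time is discrete, $t=0,1,2,\dots$ Step from $t$ to $t+1$. First the particles of type $1$ attempt to move (all simultaneously), then the particles of type $2$ (all simultaneously), and so on up to type $n$. A particle of type $i$ located in cell $(x_1,\dots,x_n)$ moves to the cell $(x_1,\dots,x_{i-1},x_i+1,x_{i+1},\dots,x_n)$ if that cell is vacant after the moves of the particles of types $1,\dots,i-1$ at this step and before the moves of the particles of type $i$; otherwise it stays where it is (a delay). After all the moves, each particle, independently of the others and of the past, changes its type with probability $q$, where $0\le q<1$ is constant; when it changes type, the new type is chosen uniformly among the other $n-1$ types (if $n=1$ the type never changes). The system is thus a Markov chain with a finite set of states.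 State of free movement. At time $t_0$ the system is in a state of free movement if its state at time $t_0$ is such that, at every moment $t=t_0,t_0+1,t_0+2,\dots$, all particles move (no particle is delayed) with probability $1$. *)

(* Defs.v *)
From HB Require Import structures.
From mathcomp Require Import all_boot all_order all_algebra.
From mathcomp Require Import all_classical all_reals all_analysis.

Set Implicit Arguments.
Unset Strict Implicit.
Unset Printing Implicit Defensive.

Import Order.TTheory GRing.Theory Num.Theory.

Local Open Scope classical_set_scope.
Local Open Scope ring_scope.

(* Coordinates, particles and types are numbered from 0; a particle of type
   [i] moves along the axis [i]. *)
Definition cell (n : nat) (N : 'I_n -> nat) : finType :=
  {dffun forall j : 'I_n, 'I_(N j)}.

(* [ordS] is the successor modulo [N j]. *)
Definition next_cell (n : nat) (N : 'I_n -> nat) (i : 'I_n) (c : cell N) :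
    cell N :=
  [ffun j : 'I_n => (if j == i then ordS (c j) else c j) : 'I_(N j)].

Definition state (m n : nat) (N : 'I_n -> nat) : finType :=
  {x : {ffun 'I_m -> cell N} * {ffun 'I_m -> 'I_n} | injectiveb x.1}.

Section BML.
Variables (m n : nat) (N : 'I_n -> nat).
Implicit Types (x y : state m N) (p : {ffun 'I_m -> cell N}).

Definition positions x : {ffun 'I_m -> cell N} := (val x).1.
Definition types x : {ffun 'I_m -> 'I_n} := (val x).2.

Definition vacant p (c : cell N) : bool := [forall k, p k != c].

(* Simultaneous move of all the particles of type [i]: vacancy is tested in the
   configuration [p] preceding this move. *)
Definition move_type (ty : {ffun 'I_m -> 'I_n}) p (i : 'I_n) :
    {ffun 'I_m -> cell N} :=
  [ffun k => if (ty k == i) && vacant p (next_cell i (p k))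
             then next_cell i (p k) else p k].

(* [enum 'I_n] lists the types in increasing order. *)
Definition after_moves x : {ffun 'I_m -> cell N} :=
  foldl (move_type (types x)) (positions x) (enum 'I_n).

(* No particle is delayed during the step that starts in [x].  A particle
   attempts at most one move per step, and a target cell equal to its own cell
   (side length 1) is not vacant, so it is delayed iff its cell is unchanged. *)
Definition all_move x : bool :=
  [forall k, after_moves x k != positions x k].

Section chain.
Variables (R : realType) (q : R).

Definition type_change (a b : 'I_n) : R :=
  if n == 1%N then (b == a)%:R
  else if b == a then 1 - q else q / (n.-1)%:R.

Definition transition x y : R :=
  if positions y == after_moves x
  then \prod_(k < m) type_change (types x k) (types y k) else 0.

Fixpoint transition_iter (t : nat) x y : R :=
  if t is t'.+1 then \sum_z transition_iter t' x z * transition z y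
  else (y == x)%:R.

(* For the chain started in [x], the event that all particles move during the
   step from [t] to [t + 1] has probability 1, for every [t]. *)
Definition free_movement x : Prop :=
  forall t : nat, \sum_(y | all_move y) transition_iter t x y = 1.

(* [X] is a Markov chain started in [x0]: its finite-dimensional distributions
   are those given by [transition]. *)
Definition BML_chain d (Omega : measurableType d) (P : probability Omega R)
    (x0 : state m N) (X : nat -> Omega -> state m N) : Prop :=
  (forall t x, measurable [set w | X t w = x]) /\
  (forall (t : nat) (x : nat -> state m N),
     P [set w | forall k, (k <= t)%N -> X k w = x k] =
     ((x 0%N == x0)%:R * \prod_(k < t) transition (x k) (x k.+1))%:E).

(* The value is +oo if free movement is never reached. *)
Definition free_time (Omega : Type) (X : nat -> Omega -> state m N)
    (w : Omega) : \bar R :=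
  ereal_inf [set (t%:R)%:E | t in [set t : nat | free_movement (X t w)]].

End chain.
End BML.

(* Main.v *)
Require Import Defs.
From HB Require Import structures.
From mathcomp Require Import all_boot all_order all_algebra.
From mathcomp Require Import all_classical all_reals all_analysis.
From mathcomp Require Import measurable_realfun zify.

(** Let d be the gcd of the side lengths.  The sum of the coordinates of a cell
    is well defined modulo d, and every move increases it by 1.  In a frame that
    rotates around Z/d at speed 1 a moving particle stands still, and a delayed
    one falls back by exactly 1; the position in this frame, counted from a
    chosen cut a, is called [level a] below.

    A particle can only be delayed by one that lies on the next level, or by one
    of its own level that moves at the same step ([delay_level]).  So a set of
    particles on one level cannot be delayed as a whole unless the next level is
    occupied: delays spread the particles out backwards, up to two levels per
    particle.  Since 2m <= d, there is room for this.  As in the cycle lemma (or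
    for parking functions) some cut of the circle has, for every l, at most l/2
    particles on the l levels that follow it ([exists_sparse]).  This property,
    [sparse], is preserved by every step, whatever the types are
    ([sparse_after]); it says in particular that level 0 is always empty, so no
    particle ever falls back across the cut.  The sum of the levels is then a
    potential that drops at each step with a delay, and along every trajectory
    the number of such steps is at most m d ([sum_delay_prob_le]).

    A state that is not of free movement has a positive probability of a later
    delay; as there are finitely many states, this probability is at least some
    e > 0 within a fixed number K of steps ([delay_window]).  Hence each unit of
    time spent outside free movement costs at least e expected delays in the next
    K steps, each delay is counted at most K times, and the sum over t of the
    probabilities that the state at time t is not free is at most K m d / e
    ([sum_nonfree_prob_le]).  The expectation of the first free time is bounded
    by that sum. *)

Set Implicit Arguments.
Unset Strict Implicit.
Unset Printing Implicit Defensive.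

Import Order.TTheory GRing.Theory Num.Theory.

(** * Moves within one step *)

Section Moves.
Local Open Scope nat_scope.
Variables (m n : nat) (N : 'I_n -> nat).
Implicit Types (ty : {ffun 'I_m -> 'I_n}) (p : {ffun 'I_m -> cell N}).
Implicit Types x : state m N.

Lemma next_cell_inj (i : 'I_n) : injective (@next_cell n N i).
Proof.
move=> c1 c2 /ffunP e; apply/ffunP => j; have := e j; rewrite !ffunE.
by case: ifP => // _ /(can_inj (@ordSK _)).
Qed.

(** Two movers of one type have distinct targets, and a mover never enters an
    occupied cell. *)
Lemma move_type_inj ty p i : injective p -> injective (move_type ty p i).
Proof.
move=> pI k l; rewrite !ffunE.
case: ifPn => [/andP[_ /forallP vk]|_]; case: ifPn => [/andP[_ /forallP vl]|_] e.
- by apply: pI; apply: next_cell_inj e.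
- by have := vk l; rewrite e eqxx.
- by have := vl k; rewrite e eqxx.
- exact: pI.
Qed.

Lemma after_moves_inj x : injective (after_moves x).
Proof.
rewrite /after_moves; have: injective (positions x) by apply/injectiveP/(valP x).
elim: (enum _) (positions x) => [//|i s IH] p pI /=.
exact/IH/move_type_inj.
Qed.

Lemma foldl_move_notin ty p s k :
  ty k \notin s -> foldl (move_type ty) p s k = p k.
Proof.
elim: s p => [//|i s IH] p /=; rewrite inE negb_or => /andP[ki ks].
by rewrite IH // ffunE (negbTE ki).
Qed.

Lemma foldl_move_cases ty p s k : uniq s ->
  foldl (move_type ty) p s k = p k \/
  (ty k \in s /\ foldl (move_type ty) p s k = next_cell (ty k) (p k)).
Proof.
elim: s p => [|i s IH] p /=; first by left.
case/andP=> is_ us; case: (eqVneq (ty k) i) => [ki|ki].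
  rewrite foldl_move_notin ?ki // ffunE ki eqxx /=.
  by case: ifP => _; [right; rewrite inE eqxx | left].
case: (IH (move_type ty p i) us) => [->|[ks ->]]; rewrite ffunE (negbTE ki) /=.
  by left.
by right; rewrite inE ks orbT.
Qed.

Lemma after_moves_cases x k :
  after_moves x k = positions x k \/
  after_moves x k = next_cell (types x k) (positions x k).
Proof.
case: (foldl_move_cases (types x) (positions x) k (enum_uniq 'I_n)).
  by left.
by case=> _; right.
Qed.

(** The blocker l sits in the target cell when the turn of the type of k comes.
    Either it was there when the step began, or it came there earlier in the same
    step, by its only move. *)
Lemma delay_blocker x k :
  (forall c : cell N, next_cell (types x k) c != c) ->
  after_moves x k = positions x k ->
  exists l, positions x l = next_cell (types x k) (positions x k) \/
    (after_moves x l != positions x l /\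
     after_moves x l = next_cell (types x k) (positions x k)).
Proof.
move=> nxt; rewrite /after_moves.
set ty := types x; set p := positions x => stuck.
(* [s1] lists the types that move before that of [k]. *)
have [s1 [s2 es]] : exists s1 s2, enum 'I_n = s1 ++ ty k :: s2.
  by case/splitPr: (mem_enum 'I_n (ty k)) => s1 s2; exists s1, s2.
have: uniq (enum 'I_n) := enum_uniq 'I_n.
rewrite es cat_uniq /= negb_or => /and3P[us1 /andP[ks1 /hasPn dis] /andP[ks2 us2]].
move: stuck; rewrite es foldl_cat /=.
set p1 := foldl _ p s1; set p2 := foldl _ _ s2 => stuck.
have := stuck; rewrite /p2 foldl_move_notin // ffunE eqxx /=.
have -> : p1 k = p k by rewrite /p1 foldl_move_notin.
case: ifPn => [_ /eqP|]; first by rewrite (negbTE (nxt _)).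
case/forallPn => l; rewrite negbK => /eqP el _; exists l.
case: (foldl_move_cases ty p l us1) => [e|[ls1 e]]; first by left; rewrite -e -el.
have e' : p2 l = p1 l.
  rewrite /p2 foldl_move_notin.
    by rewrite ffunE; case: eqP => // kl; rewrite -kl ls1 in ks1.
  by apply/negP => /dis; rewrite /= ls1.
case: (eqVneq (p1 l) (p l)) => [e2|ne]; first by left; rewrite -e2.
by right; rewrite e'.
Qed.

End Moves.

(** * Levels and the spreading of the particles *)

Section Levels.
Local Open Scope nat_scope.
Variables (m n : nat) (N : 'I_n -> nat) (d : nat).
Hypotheses (d_gt1 : 1 < d) (dvdN : forall j, d %| N j).
Implicit Types (p : {ffun 'I_m -> cell N}) (c : cell N) (x y : state m N).

(** The numbers a and a + d - 1 label the same cut seen at two successive times: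
    modulo d the second one subtracts the progress made by a moving particle. *)
Definition level a c : nat := (\sum_j c j + a) %% d.

Lemma level_lt a c : level a c < d.
Proof. by rewrite ltn_mod ltnW. Qed.

Lemma level_next a i c : level a (next_cell i c) = (level a c).+1 %% d.
Proof.
rewrite /level -[_.+1]addn1 modnDml addnAC.
rewrite (bigD1 i) //= [in RHS](bigD1 i) //= !ffunE eqxx /=.
have -> : \sum_(j < n | j != i) next_cell i c j = \sum_(j < n | j != i) c j.
  by apply: eq_bigr => j ji; rewrite ffunE (negbTE ji).
rewrite [_ + _ + 1]addnAC -!addnA -[LHS]modnDml modn_dvdm // modnDml.
by rewrite -[in LHS]addn1 !addnA.
Qed.

Lemma next_neq i c : next_cell i c != c.
Proof.
apply/eqP => e; have := level_next 0 i c; rewrite e.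
have := level_lt 0 c; move: (level 0 c) => l ld.
case: (ltngtP l.+1 d) => [h|h|h]; last by rewrite h modnn; lia.
- by rewrite modn_small //; lia.
- by lia.
Qed.

Lemma level_shift a c : level (a + d.-1) c = (level a c + d.-1) %% d.
Proof. by rewrite /level addnA modnDml. Qed.

Lemma level_shift_next a i c : level (a + d.-1) (next_cell i c) = level a c.
Proof.
rewrite level_shift level_next modnDml.
have -> : (level a c).+1 + d.-1 = level a c + d by lia.
by rewrite modnDr modn_small ?level_lt.
Qed.

Lemma level_shift_stay a c : 0 < level a c ->
  level (a + d.-1) c = (level a c).-1.
Proof.
move=> l0; rewrite level_shift.
have -> : level a c + d.-1 = (level a c).-1 + d by lia.
by rewrite modnDr modn_small //; have := level_lt a c; lia.
Qed.

Definition count_below a p l := #|[set k | level a (p k) < l]|.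

(** For l = 1 this makes level 0 empty, and it bounds by (j + 1)/2 the number of
    particles on the levels 1, ..., j. *)
Definition sparse a p := forall l, l <= d -> 2 * count_below a p l <= l.

Lemma sparse_level_gt0 a p k : sparse a p -> 0 < level a (p k).
Proof.
move=> sp; rewrite lt0n; apply/eqP => l0.
have : 0 < count_below a p 1 by apply/card_gt0P; exists k; rewrite inE l0.
by have := sp 1 (ltnW d_gt1); lia.
Qed.

Definition delayed x k := after_moves x k == positions x k.

Lemma level_after a x k : sparse a (positions x) ->
  level (a + d.-1) (after_moves x k) + delayed x k = level a (positions x k).
Proof.
move=> sp; have l0 := sparse_level_gt0 k sp; rewrite /delayed.
case: eqVneq => [->|ne]; first by rewrite level_shift_stay //; lia.
case: (after_moves_cases x k) => e; first by rewrite e eqxx in ne.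
by rewrite e level_shift_next addn0.
Qed.

(** In the second case l and k reach the same cell from the same level, and l
    does it before the turn of k. *)
Lemma delay_level a x k : delayed x k -> exists l,
  level a (positions x l) = (level a (positions x k)).+1 %% d \/
  (level a (positions x l) = level a (positions x k) /\ ~~ delayed x l).
Proof.
move=> /eqP /(delay_blocker (next_neq _)) [l [e|[ne e]]]; exists l.
  by left; rewrite e level_next.
right; split=> //; case: (after_moves_cases x l) => e'; first by rewrite e' eqxx in ne.
by rewrite -(level_shift_next a (types x l)) -e' e level_shift_next.
Qed.

Lemma leq_count_below a a' p p' l l' :
  (forall k, level a (p k) < l -> level a' (p' k) < l') ->
  count_below a p l <= count_below a' p' l'.
Proof.
by move=> sub; apply/subset_leq_card/fintype.subsetP => k; rewrite !inE => /sub.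
Qed.

Lemma ltn_count_below a a' p p' l l' k0 :
  (forall k, level a (p k) < l -> level a' (p' k) < l') ->
  l <= level a (p k0) -> level a' (p' k0) < l' ->
  count_below a p l < count_below a' p' l'.
Proof.
move=> sub l1 l2; apply/proper_card/properP; split.
  by apply/fintype.subsetP => k; rewrite !inE => /sub.
by exists k0; rewrite !inE // -leqNgt.
Qed.

(** During one step, levels below l can gain only the delayed particles of level
    l.  If they gain enough to exceed l/2, then the levels below l + 1 were
    already filled to (l + 1)/2, level l was occupied, and its particles were all
    delayed.  By sparseness at l + 2 level l + 1 was then empty (for l = d - 1 it
    is level 0, also empty), so nothing but a moving particle of level l could
    delay them, and there was none.  For l = d the gain is zero, since every
    particle was already below level d. *)
Lemma sparse_after a x :
  sparse a (positions x) -> sparse (a + d.-1) (after_moves x).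
Proof.
move=> sp l ld; rewrite leqNgt; apply/negP => big.
pose lev k := level a (positions x k).
have lev0 k : 0 < lev k by exact: sparse_level_gt0.
have levE k := level_after k sp.
have sub k : level (a + d.-1) (after_moves x k) < l ->
             level a (positions x k) < l.+1 by rewrite -levE; lia.
have ltd : l < d.
  rewrite ltn_neqAle ld andbT; apply/negP => /eqP e; have := sp d (leqnn _).
  suff : count_below (a + d.-1) (after_moves x) l <= count_below a (positions x) d.
    by lia.
  by apply: leq_count_below => k _; rewrite level_lt.
have sp1 := sp _ ltd.
have all_delayed k : lev k = l -> delayed x k.
  move=> e; apply: contraT => mov.
  have := ltn_count_below (k0 := k) sub.
  have := levE k; rewrite (negbTE mov) -/(lev k) e addn0 => ->.
  by move=> /(_ (leqnn _) (ltnSn _)); lia.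
have [k klev] : exists k, lev k = l.
  apply: contrapT => no; have := sp l ld.
  suff : count_below (a + d.-1) (after_moves x) l <= count_below a (positions x) l.
    by lia.
  apply: leq_count_below => k /sub; rewrite ltnS leq_eqVlt => /orP[/eqP e|//].
  by case: no; exists k.
have [k' []] := delay_level a (all_delayed k klev); rewrite -!/(lev _) klev.
  case: (ltngtP l.+1 d) => [h|h|h]; last 2 first.
  - by lia.
  - by have := lev0 k'; rewrite h modnn; lia.
  rewrite modn_small // => lev'; have := sp _ h.
  suff : count_below (a + d.-1) (after_moves x) l < count_below a (positions x) l.+2.
    by lia.
  by apply: (ltn_count_below (k0 := k')) => [k2 /sub||]; have := levE k';
    rewrite -/(lev _) lev'; case: delayed; lia.
by case=> /all_delayed ->.
Qed.

(** Cycle lemma: walk once around the circle, going down by 1 at each level and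
    up by 2 at each particle, and cut where the walk is highest.  The total
    increment 2m - d is nonpositive, so after the cut the walk never gets above
    its value there, even when it wraps around. *)
Lemma exists_sparse p : m.*2 <= d -> exists a, sparse a p.
Proof.
move=> md; pose C j := #|[set k | level 0 (p k) < j]|.
(* Adding [d] turns the height [2 * C j - j] of the walk into a natural number. *)
case: (@arg_maxnP _ (ord0 : 'I_d.+1) xpredT (fun j => 2 * C j + (d - j))) => // j _ jmax.
have {}jmax i : i <= d -> 2 * C i + (d - i) <= 2 * C j + (d - j).
  by move=> id; have := jmax (inord i) isT; rewrite inordK.
have jd : j <= d by rewrite -ltnS.
exists (d - j) => l ld.
have levE k : level (d - j) (p k) =
    if j <= level 0 (p k) then level 0 (p k) - j else level 0 (p k) + d - j.
  rewrite {1}/level -modnDml -[X in X %% d + _]addn0 -/(level 0 (p k)).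
  have lt := level_lt 0 (p k); case: (leqP j (level 0 (p k))) => h.
    have -> : level 0 (p k) + (d - j) = level 0 (p k) - j + d by lia.
    by rewrite modnDr modn_small //; lia.
  by rewrite modn_small; lia.
have splitC (A B : pred 'I_m) : (forall k, ~~ (A k && B k)) ->
    #|[set k | A k || B k]| = #|[set k | A k]| + #|[set k | B k]|.
  move=> dis; rewrite -[RHS]subn0.
  rewrite -[X in _ - X](_ : #|[set k | A k] :&: [set k | B k]| = 0).
    by rewrite -cardsUI addnK; apply: eq_card => k; rewrite !inE.
  by apply: eq_card0 => k; rewrite !inE; apply/negbTE/dis.
have := jmax.
case: (leqP (j + l) d) => h.
  have -> : count_below (d - j) p l = C (j + l) - C j.
    suff -> : C (j + l) = C j + count_below (d - j) p l by rewrite addKn.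
    rewrite -splitC.
      by apply: eq_card => k; rewrite !inE levE; have := level_lt 0 (p k);
        case: (leqP j (level 0 (p k))); lia.
    by move=> k; rewrite levE; have := level_lt 0 (p k);
      case: (leqP j (level 0 (p k))); lia.
  by move/(_ _ h); lia.
move=> /(_ (j + l - d)) J.
(* Here the [l] levels wrap around the origin of Z/d. *)
suff : count_below (d - j) p l + C j = m + C (j + l - d) by lia.
have := cardC [set k | level 0 (p k) < j]; rewrite -/(C j) card_ord => <-.
rewrite -addnA [RHS]addnC; congr (_ + _).
have -> : #|[predC [set k | level 0 (p k) < j]]| = #|[set k | j <= level 0 (p k)]|.
  by apply: eq_card => k; rewrite !inE -leqNgt.
rewrite -splitC.
  by apply: eq_card => k; rewrite !inE levE; have := level_lt 0 (p k);
    case: (leqP j (level 0 (p k))); lia.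
by move=> k; lia.
Qed.

Definition potential a p := \sum_k level a (p k).

Lemma potential_after a x : sparse a (positions x) ->
  potential (a + d.-1) (after_moves x) + ~~ all_move x <=
  potential a (positions x).
Proof.
move=> sp; rewrite /potential -(eq_bigr _ (fun k _ => level_after k sp)) big_split /=.
rewrite leq_add2l; case: (boolP (all_move x)) => // /forallPn [k].
by rewrite negbK => /eqP e; rewrite (bigD1 k) //= /delayed e eqxx.
Qed.

Lemma potential_le a p : potential a p <= m * d.
Proof.
rewrite -[m in leqRHS]card_ord -sum_nat_const.
by apply: leq_sum => k _; apply/ltnW/level_lt.
Qed.

End Levels.

(** * Expected number of delays *)

Section Kernel.
Local Open Scope ring_scope.
Variables (m n : nat) (N : 'I_n -> nat) (R : realType) (q : R).
Hypotheses (q_ge0 : 0 <= q) (q_lt1 : q < 1).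
Implicit Types (x y z : state m N).

Lemma type_change_ge0 (a b : 'I_n) : 0 <= type_change q a b.
Proof.
rewrite /type_change; case: ifP => // _; case: ifP => // _; last exact: divr_ge0.
by rewrite subr_ge0 ltW.
Qed.

Lemma type_change_sum (a : 'I_n) : \sum_b type_change q a b = 1.
Proof.
rewrite (bigD1 a) //= {1}/type_change eqxx.
have [n1|n1] := boolP (n == 1%N).
  rewrite big1 ?addr0 // => b; rewrite /type_change n1.
  by move=> /negbTE ->.
rewrite (eq_bigr (fun=> q / (n.-1)%:R)) => [|b /negbTE ba]; last first.
  by rewrite /type_change (negbTE n1) ba.
rewrite sumr_const cardC1 card_ord -[_ *+ _]mulr_natr mulfVK ?subrK //.
by rewrite pnatr_eq0; have := ltn_ord a; lia.
Qed.

Lemma transition_ge0 x y : 0 <= transition q x y.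
Proof.
rewrite /transition; case: ifP => // _.
by apply: prodr_ge0 => k _; apply: type_change_ge0.
Qed.

(** The positions after a step are determined, so the sum runs over the new types
    and factors over the particles; the new positions do make a state because
    moves keep the cells distinct. *)
Lemma transition_sum x : \sum_y transition q x y = 1.
Proof.
have injb : injectiveb (after_moves x) by apply/injectiveP/after_moves_inj.
pose next (ty : {ffun 'I_m -> 'I_n}) : state m N := Sub (after_moves x, ty) injb.
rewrite -big_mkcond /= (reindex_onto next (@types m n N)) /=; last first.
  move=> y /eqP e; apply: val_inj; rewrite /= -e.
  by rewrite /positions /types -surjective_pairing.
rewrite (eq_bigl xpredT) => [|ty]; last by rewrite /positions /types /= !eqxx.
rewrite -(bigA_distr_bigA (fun k => type_change q (types x k))).
by apply: big1 => k _; apply: type_change_sum.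
Qed.

Lemma transition_iter_ge0 t x y : 0 <= transition_iter q t x y.
Proof.
elim: t y => [|t IH] y /=; first by case: eqP.
by apply: sumr_ge0 => z _; rewrite mulr_ge0 ?IH ?transition_ge0.
Qed.

Lemma transition_iter_sum t x : \sum_y transition_iter q t x y = 1.
Proof.
elim: t => [|t IH] /=.
  by rewrite (bigD1 x) //= eqxx big1 ?addr0 // => y /negbTE ->.
rewrite exchange_big /= -[RHS]IH; apply: eq_bigr => z _.
by rewrite -big_distrr /= transition_sum mulr1.
Qed.

Lemma transition_iterD s t x y :
  transition_iter q (s + t) x y =
  \sum_z transition_iter q s x z * transition_iter q t z y.
Proof.
elim: t y => [|t IH] y /=.
  rewrite addn0 (bigD1 y) //= eqxx mulr1 big1 ?addr0 // => z zy.
  by rewrite eq_sym (negbTE zy) mulr0.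
rewrite addnS /= (eq_bigr _ (fun z _ => congr1 (fun u => u * _) (IH z))).
under eq_bigr => z _ do rewrite big_distrl /=.
rewrite exchange_big /=; apply: eq_bigr => z _; rewrite big_distrr /=.
by apply: eq_bigr => w _; rewrite mulrA.
Qed.

(** The expected number of steps with a delay is obtained by summing this over
    time. *)
Definition delay_prob t x : R := \sum_(y | ~~ all_move y) transition_iter q t x y.

Lemma delay_prob_ge0 t x : 0 <= delay_prob t x.
Proof. by apply: sumr_ge0 => y _; apply: transition_iter_ge0. Qed.

Lemma delay_prob0 x : delay_prob 0 x = (~~ all_move x)%:R.
Proof.
rewrite /delay_prob /= big_mkcond (bigD1 x) //= eqxx big1 ?addr0 => [|y /negbTE ->].
  by case: ifP.
by case: ifP.
Qed.

Lemma delay_probD s t x :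
  delay_prob (s + t) x = \sum_z transition_iter q s x z * delay_prob t z.
Proof.
rewrite /delay_prob (eq_bigr _ (fun y _ => transition_iterD s t x y)) exchange_big.
by apply: eq_bigr => z _; rewrite big_distrr.
Qed.

Lemma free_movementP x : free_movement q x <-> forall t, delay_prob t x = 0.
Proof.
have tot t : \sum_(y | all_move y) transition_iter q t x y + delay_prob t x = 1.
  by rewrite -[RHS](transition_iter_sum t x) [RHS](bigID (@all_move m n N)).
split=> free t; have := tot t; last by rewrite free addr0.
by rewrite free -[RHS]addr0 => /addrI.
Qed.

Lemma transition_iter1 x y : transition_iter q 1 x y = transition q x y.
Proof.
rewrite /= (bigD1 x) //= eqxx mul1r big1 ?addr0 // => z /negbTE ->.
by rewrite mul0r.
Qed.

Lemma delay_probS t x : delay_prob t.+1 x = \sum_z transition q x z * delay_prob t z.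
Proof.
rewrite -add1n delay_probD.
by apply: eq_bigr => z _; rewrite transition_iter1.
Qed.

Section Expected_delays.
Variable d : nat.
Hypotheses (d_gt1 : (1 < d)%N) (dvdN : forall j, (d %| N j)%N).

(** Each step pays for its delay with the potential; the bound holds for each
    transition of positive probability, hence in the mean. *)
Lemma sum_delay_prob_potential T a x : sparse d a (positions x) ->
  \sum_(t < T) delay_prob t x <= (potential d a (positions x))%:R.
Proof.
elim: T a x => [|T IH] a x sp; first by rewrite big_ord0.
rewrite big_ord_recl delay_prob0 addrC.
have pot := potential_after d_gt1 dvdN sp.
apply: (@le_trans _ _ ((potential d (a + d.-1) (after_moves x))%:R + (~~ all_move x)%:R)).
  rewrite lerD2r.
  rewrite -[leRHS]mul1r -[X in X * _](transition_sum x) big_distrl /=.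
  under eq_bigr => t _ do rewrite /bump /= add1n delay_probS.
  rewrite exchange_big /=; apply: ler_sum => z _; rewrite -big_distrr /=.
  have [e|ne] := eqVneq (positions z) (after_moves x).
    rewrite -e; apply: ler_wpM2l; first exact: transition_ge0.
    by apply: IH; rewrite e; apply: sparse_after.
  by rewrite /transition (negbTE ne) !mul0r.
by rewrite -natrD ler_nat.
Qed.

Hypothesis md : (m.*2 <= d)%N.

Lemma sum_delay_prob_le T x : \sum_(t < T) delay_prob t x <= (m * d)%:R.
Proof.
have [a sp] := exists_sparse d_gt1 (positions x) md.
by apply: le_trans (sum_delay_prob_potential T sp) _; rewrite ler_nat potential_le.
Qed.

Definition nonfree_prob t x : R :=
  \sum_(y | ~~ `[< free_movement q y >]) transition_iter q t x y.

(** A nonfree state has a positive delay probability at some time; take the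
    largest such time and the least such probability over the finitely many
    states. *)
Lemma delay_window : exists K (e : R), 0 < e /\
  forall x, ~ free_movement q x -> e <= \sum_(s < K) delay_prob s x.
Proof.
have wit x : exists t, ~ free_movement q x -> 0 < delay_prob t x.
  have [f|nf] := pselect (free_movement q x); first by exists 0%N => /(_ f).
  have /existsNP[t /eqP tx] : ~ forall t, delay_prob t x = 0 by move/free_movementP.
  by exists t => _; rewrite lt_neqAle eq_sym tx delay_prob_ge0.
have [tau tauP] := choice wit.
pose K := (\max_x tau x).+1.
pose g x := if `[< free_movement q x >] then 1 else delay_prob (tau x) x.
have g0 x : 0 < g x.
  by rewrite /g; case: asboolP => // nf; apply: tauP.
(* The state type may be empty, hence the two cases. *)
have [e [e0 eg]] : exists e, 0 < e /\ forall x, e <= g x.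
  case: (pickP (xpredT : pred (state m N))) => [x0 _|no]; last first.
    by exists 1; split => // x; have := no x.
  have [i _ imin] := arg_minP g (isT : xpredT x0).
  by exists (g i); split => // x; apply: imin.
exists K, e; split=> // x nf; apply: le_trans (eg x) _.
rewrite /g; case: asboolP => // _.
have tK : (tau x < K)%N by rewrite ltnS leq_bigmax.
rewrite (bigD1 (Ordinal tK)) //= lerDl; apply: sumr_ge0 => t _.
exact: delay_prob_ge0.
Qed.

(** Double counting of the pairs (t, s) with s < K and a delay at time t + s:
    each nonfree time t contributes at least e in the mean, and for each s there
    are at most m d delays. *)
Lemma sum_nonfree_prob_le : exists C : R, forall T x, \sum_(t < T) nonfree_prob t x <= C.
Proof.
have [K [e [e0 win]]] := delay_window.
exists ((K * (m * d))%:R / e) => T x; rewrite ler_pdivlMr // mulrC big_distrr /=.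
apply: (@le_trans _ _ (\sum_(t < T) \sum_(s < K) delay_prob (t + s) x)).
  apply: ler_sum => t _.
  under [leRHS]eq_bigr => s _ do rewrite delay_probD.
  rewrite exchange_big /= /nonfree_prob big_distrr big_mkcond /=.
  apply: ler_sum => z _; rewrite -big_distrr /=.
  have S0 : 0 <= \sum_(s < K) delay_prob s z.
    by apply: sumr_ge0 => s _; apply: delay_prob_ge0.
  case: asboolP => [_|nf] /=; first by rewrite mulr_ge0 ?transition_iter_ge0.
  by rewrite mulrC ler_wpM2l ?transition_iter_ge0 ?win.
rewrite exchange_big /= natrM mulr_natl -[X in _ *+ X](card_ord K) -sumr_const.
apply: ler_sum => s _; apply: le_trans (sum_delay_prob_le (s + T) x).
rewrite big_split_ord /=; under eq_bigr => t _ do rewrite addnC.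
by rewrite lerDr; apply: sumr_ge0 => t _; apply: delay_prob_ge0.
Qed.

End Expected_delays.
End Kernel.

(** * The chain and its time of free movement *)

Local Open Scope classical_set_scope.
Local Open Scope ring_scope.

Section Measure_facts.
Variables (disp : measure_display) (Omega : measurableType disp) (R : realType).
Variable mu : {measure set Omega -> \bar R}.

Lemma measure_finite_partition (S : finType) (Y : Omega -> S) (p : pred S) :
  (forall z, measurable [set w | Y w = z]) ->
  forall A, measurable A ->
  mu (A `&` [set w | p (Y w)]) = (\sum_(z | p z) mu (A `&` [set w | Y w = z]))%E.
Proof.
move=> mY A mA; pose F z := A `&` [set w | Y w = z].
have -> : A `&` [set w | p (Y w)] = \bigcup_(z in [set` enum p]) F z.
  apply/seteqP; split=> [w [Aw pw]|w [z /=]].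
    by exists (Y w) => //=; rewrite mem_enum.
  by rewrite mem_enum => pz [Aw /= e]; split=> /=; [exact: Aw|rewrite e].
rewrite measure_fin_bigcup //.
- by rewrite -fsbig_seq ?enum_uniq // big_enum.
- by move=> z z' _ _ [w [[_ /= e] [_ /= e']]]; rewrite -e -e'.
- by move=> z _; apply: measurableI.
Qed.

(** The integral of a nonnegative function is a supremum over the simple functions
    below it, which is monotone in the function.  This avoids the measurability
    of the first free time. *)
Lemma integral_le_nonmeasurable (f g : Omega -> \bar R) :
  (forall w, 0 <= f w)%E -> (forall w, f w <= g w)%E ->
  (\int[mu]_w f w <= \int[mu]_w g w)%E.
Proof.
move=> f0 fg; rewrite !ge0_integralTE //; last by move=> w; apply: le_trans (fg w).
by apply: ereal_sup_le => _ [h hf <-]; exists h => // w; apply: le_trans (fg w).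
Qed.

End Measure_facts.

Section Process.
Variables (m n : nat) (N : 'I_n -> nat) (R : realType) (q : R).
Variables (disp : measure_display) (Omega : measurableType disp).
Variables (P : probability Omega R) (x0 : state m N).
Variables (X : nat -> Omega -> state m N) (hX : BML_chain q P x0 X).

Definition path_event s t (x : nat -> state m N) : set Omega :=
  [set w | forall k, (s <= k <= t)%N -> X k w = x k].

Lemma measurable_path_event s t x : measurable (path_event s t x).
Proof.
have -> : path_event s t x =
    \bigcap_(k in [set k | (s <= k <= t)%N]) [set w | X k w = x k].
  by apply/seteqP; split => w h k; apply: h.
by apply: bigcap_measurableType => k _; apply: hX.1.
Qed.

(** The law of the segment from s to t follows from that of the whole path by
    forgetting the states before s one at a time. *)
Lemma path_event_prob s t x : (s <= t)%N ->
  P (path_event s t x) = (transition_iter q s x0 (x s) *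
    \prod_(s <= k < t) transition q (x k) (x k.+1))%:E.
Proof.
elim: s x => [|s IH] x st.
  rewrite big_mkord -hX.2; congr (P _).
have := measure_finite_partition P xpredT (hX.1 s) (measurable_path_event s.+1 t x).
have -> : [set w | xpredT (X s w)] = setT by apply/seteqP; split.
rewrite setIT => ->.
rewrite /= big_distrl /= -sumEFin; apply: eq_bigr => z _.
pose x' k := if k == s then z else x k.
have -> : path_event s.+1 t x `&` [set w | X s w = z] = path_event s t x'.
  apply/seteqP; split => [w [h hs] k|w h].
    rewrite /x'; case: eqP => [-> //|ks] kt; apply: h; lia.
  split=> [k kt|/=].
    by rewrite h; [rewrite /x'; case: eqP => //; lia|lia].
  by rewrite h /x' ?eqxx //; lia.
rewrite IH 1?ltnW // (big_ltn st) /x' eqxx -mulrA.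
rewrite (gtn_eqF (ltnSn s)); congr (_ * (_ * _))%:E.
apply: eq_big_nat => k kt; rewrite !gtn_eqF //; lia.
Qed.

Lemma state_prob t y : P [set w | X t w = y] = (transition_iter q t x0 y)%:E.
Proof.
have := path_event_prob (fun=> y) (leqnn t).
rewrite big_geq // mulr1 => <-; congr (P _).
apply/seteqP; split => [w /= h k|w]; last by apply; rewrite leqnn.
by rewrite -eqn_leq => /eqP <-.
Qed.

Definition nonfree_event t : set Omega := [set w | ~~ `[< free_movement q (X t w) >]].

Lemma nonfree_eventE t :
  nonfree_event t = \bigcup_(z in [set z | ~ free_movement q z]) [set w | X t w = z].
Proof.
apply/seteqP; split => [w /asboolPn h|w [z nf /= e]]; first by exists (X t w).
by apply/asboolPn; rewrite e.
Qed.

Lemma measurable_nonfree_event t : measurable (nonfree_event t).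
Proof.
rewrite nonfree_eventE; apply: fin_bigcup_measurable => [|z _].
  exact: finite_finset.
exact: hX.1.
Qed.

Lemma nonfree_event_prob t : P (nonfree_event t) = (nonfree_prob q t x0)%:E.
Proof.
have := measure_finite_partition P (fun z => ~~ `[< free_movement q z >]) (hX.1 t)
  measurableT.
rewrite setTI => ->; rewrite /nonfree_prob -sumEFin.
by apply: eq_bigr => z _; rewrite setTI; exact: state_prob.
Qed.

(** Before the first free time t every state is nonfree, which contributes t to
    the series; if there is no free time the series diverges. *)
Lemma free_time_le w :
  (free_time q X w <= \sum_(t <oo) (\1_(nonfree_event t) w)%:E)%E.
Proof.
have ind0 t : (0 <= (\1_(nonfree_event t) w : R)%:E)%E by rewrite lee_fin.
have partial k : (forall t, (t < k)%N -> ~ free_movement q (X t w)) ->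
    ((k%:R : R)%:E <= \sum_(t <oo) (\1_(nonfree_event t) w)%:E)%E.
  move=> nf; apply: le_trans (nneseries_lim_ge k _) => //.
  rewrite sumEFin lee_fin (eq_big_nat _ _ (F2 := fun=> 1)) ?sumr_const_nat ?subn0 //.
  by move=> t /andP[_ tk]; rewrite indicE mem_set //=; apply/asboolPn/nf.
have [[t ft]|never] := pselect (exists t, free_movement q (X t w)).
  have ex : exists t, `[< free_movement q (X t w) >] by exists t; apply/asboolP.
  case: (ex_minnP ex) => k /asboolP fk kmin; apply: le_trans (partial k _).
    by apply: ereal_inf_lbound; exists k.
  by move=> s sk /asboolP/kmin; rewrite leqNgt sk.
suff -> : (\sum_(t <oo) (\1_(nonfree_event t) w : R)%:E)%E = +oo%E by exact: leey.
apply/eqyP => r _.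
apply: le_trans (partial (Num.truncn `|r|).+1 _); last first.
  by move=> t _ ft; apply: never; exists t.
rewrite lee_fin; apply: le_trans (ler_norm r) _.
exact/ltW/truncnS_gt.
Qed.

Hypotheses (q_ge0 : 0 <= q) (q_lt1 : q < 1).
Variable d : nat.
Hypotheses (d_gt1 : (1 < d)%N) (dvdN : forall j, (d %| N j)%N) (md : (m.*2 <= d)%N).

Lemma expected_free_time_lty : (\int[P]_w free_time q X w < +oo)%E.
Proof.
have [C CP] := sum_nonfree_prob_le q_ge0 q_lt1 d_gt1 dvdN md.
apply: (@le_lt_trans _ _ C%:E); last exact: ltry.
have ft0 w : (0 <= free_time q X w)%E.
  by apply/ereal_infP => _ [t _ <-]; rewrite lee_fin.
apply: le_trans (integral_le_nonmeasurable P ft0 free_time_le) _.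
rewrite integral_nneseries //; last first.
  move=> t; apply/measurable_EFinP; apply: measurable_indic.
  exact: measurable_nonfree_event.
apply: lime_le; first by apply: is_cvg_nneseries => t _ _; apply: integral_ge0.
apply: nearW => T; apply: le_trans (_ : (\sum_(t < T) nonfree_prob q t x0)%:E <= _)%E;
  last by rewrite lee_fin.
rewrite big_mkord -sumEFin; apply: lee_sum => t _.
rewrite integral_indic ?setIT //; last exact: measurable_nonfree_event.
by rewrite -nonfree_event_prob.
Qed.

End Process.

Theorem theorem1 (R : realType) (n m : nat) (N : 'I_n -> nat) (q : R)
    (hn : (1 <= n)%N) (hN : forall j : 'I_n, (0 < N j)%N)
    (hm1 : (1 <= m)%N) (hm2 : (m < \prod_(j < n) N j)%N)
    (hq0 : 0 <= q) (hq1 : q < 1)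
    (hmd : (m%:R : R) <= (\big[gcdn/0%N]_(j < n) N j)%:R / 2)
    (x0 : state m N)
    (d : measure_display) (Omega : measurableType d) (P : probability Omega R)
    (X : nat -> Omega -> state m N) (hX : BML_chain q P x0 X) :
  (\int[P]_w free_time q X w < +oo)%E.
Proof.
have md : (m.*2 <= \big[gcdn/0%N]_(j < n) N j)%N.
  by rewrite -(ler_nat R) -muln2 natrM -ler_pdivlMr.
apply: (expected_free_time_lty hX hq0 hq1 _ _ md).
  by apply: leq_trans md; rewrite -addnn; lia.
by move=> j; rewrite (bigD1 j) //= dvdn_gcdl.
Qed.
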